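(* Fix a difference equation $\pmb\omega=(1/f,q,w)$. Let $$\mathbf{A}(a_{11},b_{21}):=\left [\begin{array} {cccc}a_{11}&-1&\bar{z}&0\\ z&0&b_{21}&1\end{array} \right ] \in \mathcal{O}_{2,4}^{\mathbb{C}},$$ and let $$\mathbf{S}_3:=\left [\begin{array} {cccc}1&0&0&0\\ 0&0&b_{21}&1\end{array} \right ],\qquad \mathbf{S}_4:=\left [\begin{array} {cccc}a_{11}&-1&0&0\\ 0&0&1&0\end{array} \right ].$$ Then $(\pmb\omega, \mathbf{A}(a_{11},b_{21}))$ has exactly $N$ eigenvalues if $a_{11}\neq -f_0$ and exactly $N-1$ eigenvalues if $a_{11}=-f_0$; $(\pmb\omega, \mathbf{S}_3)$ has exactly $N$ eigenvalues in any case; $(\pmb\omega, \mathbf{S}_4)$ has exactly $N-1$ eigenvalues if $a_{11}\neq -f_0$ and exactly $N-2$ eigenvalues if $a_{11}=-f_0$. Further, for any $a_{11}^{(1)}<a_{11}^{(2)}\leq -f_0<a_{11}^{(3)}<a_{11}^{(4)}$ and $b_{21}^{(1)}<b_{21}^{(2)}$: (i) the eigenvalues $\lambda_n(a_{11}^{(i)})$ of $(\pmb\omega, \mathbf{A}(a_{11}^{(i)},b_{21}))$, $i=1,\dots,4$, and $\lambda_n(\mathbf{S}_3)$ of $(\pmb\omega,\mathbf{S}_3)$ satisfy $$\lambda_0(a_{11}^{(3)})\leq\lambda_0(a_{11}^{(4)})\leq\lambda_0(\mathbf{S}_3)\leq\lambda_0(a_{11}^{(1)})\leq\lambda_0(a_{11}^{(2)})\leq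 \lambda_1(a_{11}^{(3)})\leq\lambda_1(a_{11}^{(4)})\leq \lambda_1(\mathbf{S}_3)\leq\lambda_1(a_{11}^{(1)})\leq\lambda_1(a_{11}^{(2)})\leq \cdots\leq \lambda_{N-2}(a_{11}^{(3)})\leq\lambda_{N-2}(a_{11}^{(4)})\leq\lambda_{N-2}(\mathbf{S}_3)\leq\lambda_{N-2}(a_{11}^{(1)})\leq\lambda_{N-2}(a_{11}^{(2)})\leq \lambda_{N-1}(a_{11}^{(3)})\leq\lambda_{N-1}(a_{11}^{(4)})\leq\lambda_{N-1}(\mathbf{S}_3)\leq\lambda_{N-1}(a_{11}^{(1)}),$$ and in addition $\lambda_{N-1}(a_{11}^{(1)})\leq\lambda_{N-1}(a_{11}^{(2)})$ if $a_{11}^{(2)}<-f_0$; (ii) the eigenvalues $\lambda_n(b_{21}^{(j)})$ of $(\pmb\omega, \mathbf{A}(a_{11},b_{21}^{(j)}))$, $j=1,2$, and $\lambda_n(\mathbf{S}_4)$ of $(\pmb\omega, \mathbf{S}_4)$ satisfy $$\lambda_0(b_{21}^{(1)})\leq\lambda_0(b_{21}^{(2)})\leq\lambda_0(\mathbf{S}_4)\leq\lambda_1(b_{21}^{(1)})\leq \lambda_1(b_{21}^{(2)})\leq\lambda_1(\mathbf{S}_4)\leq\cdots\leq \lambda_{N-3}(b_{21}^{(1)})\leq\lambda_{N-3}(b_{21}^{(2)})\leq\lambda_{N-3}(\mathbf{S}_4)\leq \lambda_{N-2}(b_{21}^{(1)})\leq\lambda_{N-2}(b_{21}^{(2)}),$$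 and in addition $\lambda_{N-2}(b_{21}^{(2)})\leq \lambda_{N-2}(\mathbf{S}_4)\leq\lambda_{N-1}(b_{21}^{(1)})\leq\lambda_{N-1}(b_{21}^{(2)})$ if $a_{11}\neq -f_0$.
   Context: Discrete Sturm–Liouville problem: equation $-\nabla(f_n\Delta y_n)+q_ny_n=\lambda w_ny_n$, $n\in[1,N]$, $N\ge2$, with real $f_n\neq0$ ($0\le n\le N$), real $q_n$, $w_n>0$ ($1\le n\le N$), abbreviated $\pmb\omega=(1/f,q,w)$; boundary condition $A(y_0, f_0\Delta y_0)^T+B(y_N,f_N\Delta y_N)^T=0$ with $\operatorname{rank}(A,B)=2$, denoted $[A\,|\,B]$ (an equivalence class modulo left multiplication by invertible $2\times2$ matrices), self-adjoint: $AJA^*=BJB^*$, $J=\begin{pmatrix}0&1\\-1&0\end{pmatrix}$. $\mathcal{O}_{2,4}^{\mathbb{C}}$ is the set of BCs $\left[\begin{smallmatrix}a_{11}&-1&\bar z&0\\ z&0&b_{21}&1\end{smallmatrix}\right]$ with $a_{11},b_{21}\in\mathbb{R}$, $z\in\mathbb{C}$. All eigenvalues are real and are counted with multiplicity and listed in non-decreasing order $\lambda_0\le\lambda_1\le\cdots$. *)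

(* Defs.v *)
From HB Require Import structures.
From mathcomp Require Import all_boot all_order all_algebra.
From mathcomp Require Import complex.
Set Implicit Arguments. Unset Strict Implicit. Unset Printing Implicit Defensive.
Import Order.TTheory GRing.Theory Num.Theory.
Local Open Scope ring_scope.

(* Discrete Sturm--Liouville problem
     - nabla (f_n Delta y_n) + q_n y_n = lambda w_n y_n,   1 <= n <= N,
   i.e.  - f_n y_(n+1) + (f_n + f_(n-1) + q_n) y_n - f_(n-1) y_(n-1) = lambda w_n y_n,
   unknowns y_0, ..., y_(N+1) (complex), with boundary condition
     A (y_0, f_0 Delta y_0)^T + B (y_N, f_N Delta y_N)^T = 0,
   where A, B are 2x2 complex matrices ([A | B] is the 2x4 BC matrix).

   The problem is the square linear system  M(lambda) y = 0  in the
   N+2 unknowns y_0..y_(N+1) (index j : 'I_(N+2) stands for y_j):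
   rows 0,1 are the two boundary equations, row i (2 <= i <= N+1) is the
   difference equation at n = i - 1.  We build M as a matrix of polynomials
   in the eigenparameter lambda ('X).                                        *)

Section SLP.
Variable R : rcfType.
Local Notation C := (R[i]).
Local Notation Cr x := (real_complex R x).

Definition sl_matrix (N : nat) (f q w : nat -> R) (A B : 'M[C]_2)
  : 'M[{poly C}]_(N.+2) :=
  \matrix_(i < N.+2, j < N.+2)
    if (i < 2)%N then
      let k : 'I_2 := inord i in
      ((((val j == 0%N)%:R : C) * (A k ord0 - A k (inord 1) * Cr (f 0%N))
       + ((val j == 1%N)%:R : C) * (A k (inord 1) * Cr (f 0%N))
       + ((val j == N)%:R : C) * (B k ord0 - B k (inord 1) * Cr (f N))
       + ((val j == N.+1)%:R : C) * (B k (inord 1) * Cr (f N)))%R)%:P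
    else
      let n := i.-1 in
      (((val j == n.+1)%:R : {poly C}) * (- Cr (f n))%:P
       + ((val j == n)%:R : {poly C}) *
           ((Cr (f n + f n.-1 + q n))%:P - (Cr (w n))%:P * 'X)
       + ((val j == n.-1)%:R : {poly C}) * (- Cr (f n.-1))%:P).

Definition sl_charpoly N f q w A B : {poly C} := \det (sl_matrix N f q w A B).

Definition sl_eigenvalue N f q w A B (lam : C) : Prop :=
  exists y : 'cV[C]_(N.+2),
    y != 0 /\ map_mx (fun p : {poly C} => p.[lam]) (sl_matrix N f q w A B) *m y = 0.

Definition sl_mult N f q w A B (lam : C) : nat := mup lam (sl_charpoly N f q w A B).

(* s is the list of all eigenvalues (all real), each repeated according to
   its multiplicity, in non-decreasing order:  s = [lambda_0; lambda_1; ...] *)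
Definition sl_eigenlist N f q w A B (s : seq R) : Prop :=
  [/\ sl_charpoly N f q w A B != 0,
      sorted <=%R s &
      forall lam : C,
        sl_mult N f q w A B lam = count_mem lam [seq Cr x | x <- s]].

Definition mx2 (a b c d : C) : 'M[C]_2 :=
  \matrix_(i < 2, j < 2)
    if val i == 0%N then (if val j == 0%N then a else b)
    else (if val j == 0%N then c else d).

Definition bcA_A (a11 : R) (z : C) : 'M[C]_2 := mx2 (Cr a11) (-1) z 0.
Definition bcA_B (b21 : R) (z : C) : 'M[C]_2 := mx2 (conjc z) 0 (Cr b21) 1.
Definition bcS3_A : 'M[C]_2 := mx2 1 0 0 0.
Definition bcS3_B (b21 : R) : 'M[C]_2 := mx2 0 0 (Cr b21) 1.
Definition bcS4_A (a11 : R) : 'M[C]_2 := mx2 (Cr a11) (-1) 0 0.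
Definition bcS4_B : 'M[C]_2 := mx2 0 0 1 0.

End SLP.

(* Main.v *)
Require Import Defs.
From HB Require Import structures.
From mathcomp Require Import all_boot all_order all_algebra.
From mathcomp Require Import complex spectral sesquilinear ring zify.
Set Implicit Arguments. Unset Strict Implicit. Unset Printing Implicit Defensive.
Import Order.TTheory GRing.Theory Num.Theory.
Local Open Scope ring_scope.
Local Open Scope sesquilinear_scope.

(** Eliminating y_(N+1) with the second boundary equation turns the problem
    with boundary condition A(a, b) into a pencil H - x W of hermitian matrices
    indexed by 0..N, with W = diag(0, w_1, ..., w_N) and a, b occurring only in
    the two extreme diagonal entries; up to a nonzero constant the
    characteristic polynomial is det (H - x W).  S_3 and S_4 correspond to
    deleting the first, respectively the last, row and column of H - x W.

    Let n_-(x) be the largest dimension of a subspace on which H - x W is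
    negative definite.  A Schur complement with respect to the kernel of W (or,
    when the pivot H_00 = a + f_0 vanishes, to a hyperbolic plane containing it)
    leaves a pencil K - x W' with W' positive definite, so that the eigenvalues
    are real and n_-(x) = [a <= - f_0] + #{eigenvalues < x}.  All the
    inequalities then express that n_- decreases when a or b increases, and
    that deleting a row and the same column lowers n_- by at most one. *)

(** * Negative index of a hermitian matrix *)

Section Neg.
Variable C : numClosedFieldType.

Definition hform m (K : 'M[C]_m) (u : 'rV[C]_m) : C := (u *m K *m u^t*) 0 0.

(* The hypothesis on X forces its k rows to be linearly independent. *)
Definition has_neg m (K : 'M[C]_m) k : Prop :=
  exists X : 'M[C]_(k, m), forall v : 'rV_k, v != 0 -> hform K (v *m X) < 0.

Lemma trmxC_mul m n p (A : 'M[C]_(m, n)) (B : 'M[C]_(n, p)) :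
  (A *m B)^t* = B^t* *m A^t*.
Proof. by rewrite trmx_mul map_mxM. Qed.

Lemma hform_congr m n (E : 'M[C]_(m, n)) (K : 'M[C]_n) u :
  hform (E *m K *m E^t*) u = hform K (u *m E).
Proof. by rewrite /hform trmxC_mul !mulmxA. Qed.

Lemma has_neg_le_form m (K L : 'M[C]_m) k :
  (forall u, hform K u <= hform L u) -> has_neg L k -> has_neg K k.
Proof. by move=> leKL [X hX]; exists X => v /hX; exact: le_lt_trans. Qed.

(** [E] may be rectangular: a negative subspace is pushed forward through it. This covers changes of
    basis as well as the passage from a principal submatrix to the whole matrix. *)
Lemma has_neg_congr m n (E : 'M[C]_(m, n)) (K : 'M[C]_n) k :
  has_neg (E *m K *m E^t*) k -> has_neg K k.
Proof.
by case=> X hX; exists (X *m E) => v /hX; rewrite hform_congr mulmxA.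
Qed.

Lemma has_neg_congr_unit m (P K : 'M[C]_m) k : P \in unitmx ->
  has_neg (P *m K *m P^t*) k <-> has_neg K k.
Proof.
move=> uP; split; first exact: has_neg_congr.
move=> hK; apply: (@has_neg_congr _ _ (invmx P)).
by rewrite !mulmxA mulVmx // mul1mx -mulmxA -trmxC_mul mulVmx // trmx1 map_mx1 mulmx1.
Qed.

Lemma has_neg_leq m (K : 'M[C]_m) k l : (l <= k)%N -> has_neg K k -> has_neg K l.
Proof.
move=> lk [X hX]; exists (pid_mx l *m X) => v v0; rewrite mulmxA; apply: hX.
have rf : row_free (pid_mx l : 'M[C]_(l, k)) by rewrite /row_free rank_pid_mx.
by apply: contra v0 => /eqP h; apply/eqP; apply: (row_free_inj rf); rewrite h mul0mx.
Qed.

Lemma row'_col'_congr m (K : 'M[C]_m.+1) i (E := row' i (1%:M : 'M[C]_m.+1)) :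
  row' i (col' i K) = E *m K *m E^t*.
Proof.
rewrite -[E]mulmx1; apply/matrixP=> a b; rewrite mulmx1 !mxE (bigD1 (lift i b)) //= !mxE.
rewrite (bigD1 (lift i a)) //= !mxE !eqxx conjC1 mul1r mulr1.
rewrite big1 ?addr0 => [|c /negPf ca]; last by rewrite !mxE eq_sym ca mul0r.
rewrite big1 ?addr0 // => c /negPf ca.
by rewrite !mxE eq_sym ca conjC0 mulr0.
Qed.

Lemma has_neg_minor m (K : 'M[C]_m.+1) i k :
  has_neg (row' i (col' i K)) k -> has_neg K k.
Proof. by rewrite row'_col'_congr; exact: has_neg_congr. Qed.

(** In a negative subspace of dimension [k.+1], vanishing of the [i]-th coordinate is one linear
    condition. It leaves dimension at least [k], and there the forms of [K] and of the minor
    agree. *)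
Lemma minor_has_neg m (K : 'M[C]_m.+1) i k :
  has_neg K k.+1 -> has_neg (row' i (col' i K)) k.
Proof.
(* The rows of [Z] are a basis of the coefficient vectors whose combination of the rows of [X] has
   zero [i]-th coordinate. *)
case=> X hX; set Z := row_base (kermx (col i X)).
have rkZ : (k <= \rank (kermx (col i X)))%N.
  by rewrite mxrank_ker (leq_trans _ (leq_sub2l _ (rank_leq_col (col i X)))) ?subn1.
apply: (has_neg_leq rkZ); exists (Z *m col' i X) => v v0.
have := hX (v *m Z); rewrite row'_col'_congr hform_congr.
(* Coordinate [i] of [v *m Z *m X] is zero, so deleting it and putting a zero back changes
   nothing. *)
have -> : v *m (Z *m col' i X) *m row' i 1%:M = v *m Z *m X.
  apply/matrixP=> a b; rewrite mxE.
  have [c ->|->] := unliftP i b.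
    rewrite (bigD1 c) //= big1 ?addr0 => [|d dc]; last first.
      by rewrite !mxE [_ == _](inj_eq lift_inj) (negPf dc) mulr0.
    rewrite [X in _ * X]mxE [X in _ * X]mxE eqxx mulr1 mulmxA !mxE.
    by apply: eq_bigr => d _; rewrite !mxE.
  rewrite big1 => [|d _]; last by rewrite !mxE eq_sym (negPf (neq_lift _ _)) mulr0.
  have : v *m Z *m col i X = 0.
    rewrite -mulmxA; suff -> : Z *m col i X = 0 by rewrite mulmx0.
    by apply/sub_kermxP; rewrite eq_row_base.
  move/matrixP/(_ a 0); rewrite !mxE => h; rewrite -[LHS]h.
  by apply: eq_bigr => d _; rewrite !mxE.
apply; apply: contra v0 => /eqP h; apply/eqP.
by apply: (row_free_inj (row_base_free (kermx (col i X)))); rewrite mul0mx.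
Qed.

Lemma hform_diag m (e : 'rV[C]_m) u :
  hform (diag_mx e) u = \sum_i e 0 i * `|u 0 i| ^+ 2.
Proof.
rewrite /hform mxE; apply: eq_bigr => i _.
by rewrite mul_mx_diag !mxE normCK mulrA [u 0 i * _]mulrC.
Qed.

(** Sylvester's law of inertia for a real diagonal matrix. The coordinate vectors at the negative
    entries attain the bound; a larger subspace contains a nonzero vector vanishing at all these
    coordinates, where the form is nonnegative. *)
Lemma has_neg_diag m (e : 'rV[C]_m) k : e \is a realmx ->
  has_neg (diag_mx e) k <-> (k <= \sum_i (e 0 i < 0)%R)%N.
Proof.
move=> /mxOverP re; set J := [pred i | e 0 i < 0].
have -> : (\sum_i (e 0 i < 0)%R)%N = #|J|.
  rewrite -sum1_card [RHS]big_mkcond; apply: eq_bigr => i _.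
  by rewrite inE; case: (_ < _).
have ge i : i \notin J -> 0 <= e 0 i.
  by rewrite inE => /negPf h; rewrite real_leNgt ?h ?re // real0.
split=> [[X hX]|].
  rewrite leqNgt; apply/negP=> ltJk.
  pose A : 'M_(k, #|J|) := \matrix_(a, b) X a (enum_val b).
  have : kermx A != 0.
    by rewrite -mxrank_eq0 mxrank_ker -lt0n subn_gt0 (leq_ltn_trans _ ltJk) ?rank_leq_col.
  case/rowV0Pn => v /sub_kermxP vA /hX; rewrite hform_diag => /lt_geF/negbT/negP; apply.
  apply: sumr_ge0 => i _; have [iJ|/ge ei] := boolP (i \in J); last first.
    by rewrite mulr_ge0 // exprn_ge0.
  have -> : (v *m X) 0 i = 0.
    have /matrixP/(_ 0 (enum_rank_in iJ i)) := vA; rewrite !mxE => h.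
    by rewrite -[RHS]h; apply: eq_bigr => a _; rewrite !mxE enum_rankK_in.
  by rewrite normr0 expr0n mulr0.
move=> kJ; apply: (has_neg_leq kJ).
exists (\matrix_(a, b) (enum_val a == b)%:R) => v.
case/rV0Pn => j vj; rewrite hform_diag.
have E (i : 'I_m) (iJ : i \in J) :
    (v *m \matrix_(a < #|J|, b < m) (enum_val a == b)%:R) 0 i = v 0 (enum_rank_in iJ i).
  rewrite mxE (bigD1 (enum_rank_in iJ i)) //= mxE enum_rankK_in // eqxx mulr1.
  rewrite big1 ?addr0 // => a ai; rewrite !mxE.
  case: eqP => [h|]; last by rewrite mulr0.
  by case/eqP: ai; apply: enum_val_inj; rewrite enum_rankK_in.
have jJ := enum_valP j.
rewrite (bigD1 (enum_val j)) //=; rewrite -[X in _ < X]addr0; apply: ltr_leD.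
  rewrite (E _ jJ) enum_valK_in pmulr_llt0 ?exprn_gt0 ?normr_gt0 //.
apply: sumr_le0 => i _; have [iJ|iJ] := boolP (i \in J).
  by rewrite nmulr_rle0 ?exprn_ge0.
rewrite mxE big1 ?normr0 ?expr0n ?mulr0 // => a _; rewrite mxE.
case: eqP => [h|]; last by rewrite mulr0.
by rewrite -h enum_valP in iJ.
Qed.

End Neg.

(** * Diagonalization and block elimination of hermitian matrices *)

Section Diag.
Variable C : numClosedFieldType.

Definition posdef m (W : 'M[C]_m) := forall u : 'rV_m, u != 0 -> 0 < hform W u.

Lemma hformD m (K L : 'M[C]_m) u : hform (K + L) u = hform K u + hform L u.
Proof. by rewrite /hform mulmxDr mulmxDl mxE. Qed.

Lemma hformZ m a (K : 'M[C]_m) u : hform (a *: K) u = a * hform K u.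
Proof. by rewrite /hform -scalemxAr -scalemxAl mxE. Qed.

Lemma hform_mulC m (g : 'cV[C]_m) u : hform (g *m g^t*) u = `|(u *m g) 0 0| ^+ 2.
Proof.
rewrite -[X in X *m _]mulmx1 hform_congr /hform mulmx1.
by rewrite mxE big_ord1 !mxE normCK.
Qed.

Lemma posdef_diag m (e : 'rV[C]_m) : (forall i, 0 < e 0 i) -> posdef (diag_mx e).
Proof.
move=> e0 u /rV0Pn[j uj]; rewrite hform_diag (bigD1 j) //= ltr_pwDl //.
  by rewrite mulr_gt0 // exprn_gt0 ?normr_gt0.
by apply: sumr_ge0 => i _; rewrite mulr_ge0 ?exprn_ge0 // ltW.
Qed.

Lemma herm_congr m n (P : 'M[C]_(n, m)) (A : 'M[C]_m) :
  A^t* = A -> (P *m A *m P^t*)^t* = P *m A *m P^t*.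
Proof. by move=> hA; rewrite !trmxC_mul trmxCK hA mulmxA. Qed.

Lemma congr_mulmx m n p (P : 'M[C]_(p, n)) (Q : 'M[C]_(n, m)) (A : 'M[C]_m) :
  P *m Q *m A *m (P *m Q)^t* = P *m (Q *m A *m Q^t*) *m P^t*.
Proof. by rewrite trmxC_mul !mulmxA. Qed.

Lemma herm_spectral m (A : 'M[C]_m) : A^t* = A ->
  exists (U : 'M[C]_m) (d : 'rV[C]_m),
    [/\ U \is unitarymx, d \is a realmx & U *m A *m U^t* = diag_mx d].
Proof.
move=> hA; have hermA : A \is hermsymmx.
  by apply/is_hermitianmxP; rewrite expr0 scale1r hA.
exists (spectralmx A), (spectral_diag A); split.
- exact: spectral_unitarymx.
- exact: hermitian_spectral_diag_real.
have /hermitian_normalmx/orthomx_spectralP E := hermA.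
have uU := spectral_unit A.
rewrite [X in _ *m X *m _]E -invmx_unitary ?spectral_unitarymx // !mulmxA.
by rewrite mulmxV // mul1mx mulmxK.
Qed.

(** The spectral decomposition of [W] rescales it to the identity; the transformed [K] is then
    diagonalized by a unitary matrix, which preserves the identity. *)
Lemma posdef_codiag m (K W : 'M[C]_m) : K^t* = K -> W^t* = W -> posdef W ->
  exists (P : 'M[C]_m) (d : 'rV[C]_m), [/\ P \in unitmx, d \is a realmx, P *m W *m P^t* = 1%:M
    & P *m K *m P^t* = diag_mx d].
Proof.
move=> hK hW pW; have [U [e [uU re eU]]] := herm_spectral hW.
have e_gt0 i : 0 < e 0 i.
  have : 0 < hform W (delta_mx 0 i *m U).
    apply: pW; apply/eqP => h; have := oner_neq0 C; case/negP.
    have : delta_mx 0 i = 0 :> 'rV[C]_m.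
      by apply: (can_inj (mulmxK (unitarymx_unit uU))); rewrite h mul0mx.
    by move/matrixP/(_ 0 i)/eqP; rewrite !mxE !eqxx.
  rewrite -hform_congr eU hform_diag (bigD1 i) //= big1 => [|j /negPf ji].
    by rewrite mxE !eqxx normr1 expr1n mulr1 addr0.
  by rewrite mxE ji andbF normr0 expr0n mulr0.
pose r : 'rV[C]_m := \row_i (sqrtC (e 0 i))^-1.
pose Q := diag_mx r *m U.
have QW : Q *m W *m Q^t* = 1%:M.
  rewrite congr_mulmx eU tr_diag_mx map_diag_mx !mulmx_diag -diag_const_mx; congr diag_mx.
  apply/rowP => i; rewrite !mxE /=.
  have s0 : 0 < sqrtC (e 0 i) by rewrite sqrtC_gt0.
  have -> : Num.conj (sqrtC (e 0 i))^-1 = (sqrtC (e 0 i))^-1.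
    by apply/CrealP; rewrite rpredV realE ltW.
  rewrite mulrAC -invfM -expr2 sqrtCK mulVf // gt_eqF //.
have [V [d [uV rd eV]]] := herm_spectral (herm_congr Q hK).
exists (V *m Q), d; split => //.
- rewrite unitmx_mul unitarymx_unit //.
  by have [] := mulmx1_unit (etrans (mulmxA _ _ _) QW).
- rewrite congr_mulmx QW mulmx1.
  exact/unitarymxP.
- by rewrite congr_mulmx eV.
Qed.

Lemma det_trmxC m (P : 'M[C]_m) : \det (P^t*) = (\det P)^*.
Proof. by rewrite det_map_mx det_tr. Qed.

Lemma det_unitary_congr m (U A : 'M[C]_m) : U \is unitarymx ->
  \det (U *m A *m U^t*) = \det A.
Proof.
move=> /unitarymxP h; rewrite !det_mulmx mulrAC -det_mulmx h det1 mul1r //.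
Qed.

Lemma has_neg_herm m (A : 'M[C]_m) : A^t* = A ->
  exists d : 'rV[C]_m, [/\ d \is a realmx, \det A = \prod_i d 0 i
    & forall k, has_neg A k <-> (k <= \sum_i (d 0 i < 0)%R)%N].
Proof.
move=> /herm_spectral[U [d [uU rd eU]]]; exists d; split => //.
  by rewrite -det_diag -eU det_unitary_congr.
by move=> k; rewrite -(has_neg_diag _ rd) -eU has_neg_congr_unit ?unitarymx_unit.
Qed.

(** The determinant is the product of two real eigenvalues, so exactly one of them is negative. *)
Lemma has_neg_det2 (A : 'M[C]_2) k : A^t* = A -> \det A < 0 ->
  has_neg A k <-> (k <= 1)%N.
Proof.
case/has_neg_herm => d [/mxOverP rd dd hd]; rewrite dd hd.
rewrite !big_ord_recl !big_ord0 /= mulr1 addn0.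
set a := d _ _; set b := d _ _.
have /orP ra : (0 <= a) || (a <= 0) by exact: rd.
have /orP rb : (0 <= b) || (b <= 0) by exact: rd.
have [/eqP ->|a0] := boolP (a == 0); first by rewrite mul0r ltxx.
case: ra => ra.
  by rewrite pmulr_rlt0 ?lt0r ?a0 // => ->; rewrite le_gtF.
have a1 : a < 0 by rewrite lt_neqAle a0.
by rewrite nmulr_rlt0 // => b0; rewrite a1 lt_gtF.
Qed.

Lemma has_neg_mx11 (A : 'M[C]_1) k : A 0 0 \is Num.real ->
  has_neg A k <-> (k <= (A 0 0 < 0)%R)%N.
Proof.
move=> rA; have -> : A = diag_mx (const_mx (A 0 0)).
  by apply/matrixP => i j; rewrite !ord1 !mxE.
rewrite has_neg_diag ?big_ord1 ?mxE ?eqxx ?mulr1n //.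
by apply/mxOverP => i j; rewrite mxE.
Qed.

Lemma has_neg_mx00 (A : 'M[C]_0) k : has_neg A k <-> (k <= 0)%N.
Proof.
have -> : A = diag_mx 0 by apply/matrixP => -[].
by rewrite has_neg_diag ?big_ord0 //; apply/mxOverP => i j; rewrite mxE.
Qed.

(** [T] subtracts [Y] times the upper block row from the lower one; since [L] is hermitian, the
    adjoint column operation clears the upper right block as well. *)
Lemma schur_congr p n (L : 'M[C]_(p + n)) (Y : 'M[C]_(n, p))
  (T := block_mx 1%:M 0 (- Y) 1%:M) : L^t* = L ->
  Y *m ulsubmx L = dlsubmx L ->
  T *m L *m T^t* =
    block_mx (ulsubmx L) 0 0 (drsubmx L - Y *m ursubmx L).
Proof.
move=> hL hY; rewrite -{1}(submxK L) /T tr_block_mx map_block_mx !trmx1 !map_mx1 trmx0 map_mx0.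
rewrite !mulmx_block !mul1mx !mul0mx !mulmx1 !mulmx0 !addr0 !mulNmx hY addNr !mul0mx add0r.
rewrite [- _ + drsubmx _]addrC; congr (block_mx _ _ _ _).
rewrite linearN /= map_mxN mulmxN.
have hul : (ulsubmx L)^t* = ulsubmx L by rewrite trmx_ulsub map_ulsubmx hL.
have hur : ursubmx L = (dlsubmx L)^t* by rewrite trmx_dlsub map_ursubmx hL.
by rewrite hur -hY trmxC_mul hul addNr.
Qed.

End Diag.

(** * Spectrum of semidefinite hermitian pencils *)

Section Pencil.
Variable R : rcfType.
Local Notation C := (R[i]).
Local Notation Cr x := (real_complex R x).

(** [s] lists the roots of the determinant, and [j] is the negative index of [L x] for [x] below all
    of them. Each root passed adds one negative direction. *)
Definition pencil_spec m (L : R -> 'M[C]_m) (j : nat) (s : seq R) : Prop :=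
  [/\ sorted <=%R s,
      exists2 kappa : C, kappa != 0 & forall x, \det (L x) = kappa * \prod_(y <- s) Cr (x - y)
    & forall x k, has_neg (L x) k <-> (k <= j + count (< x) s)%N].

Lemma realmx_map m n (d : 'M[C]_(m, n)) : d \is a realmx ->
  exists e : 'M[R]_(m, n), d = map_mx (real_complex R) e.
Proof.
move=> /mxOverP rd; exists (map_mx (@complex.Re R) d); apply/matrixP => i j.
by rewrite !mxE /= RRe_real.
Qed.

(* Y x = G B^-1 for the blocks L x = [B, G^*; G, M], so drsubmx (L x) - Y x *m ursubmx (L x)
   is the Schur complement of B. *)
Lemma pencil_schur p n (L : R -> 'M[C]_(p + n)) (Y : R -> 'M[C]_(n, p))
    (K W : 'M[C]_n) (beta : C) j :
  (forall x, (L x)^t* = L x) ->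
  (forall x, Y x *m ulsubmx (L x) = dlsubmx (L x)) ->
  (forall x, drsubmx (L x) - Y x *m ursubmx (L x) = K - Cr x *: W) ->
  K^t* = K -> W^t* = W -> posdef W ->
  beta != 0 -> (forall x, \det (ulsubmx (L x)) = beta) ->
  (forall x k, has_neg (ulsubmx (L x)) k <-> (k <= j)%N) ->
  exists2 s, pencil_spec L j s & size s = n.
Proof.
move=> hL hY hM hK hW pW bet0 hbet hneg.
have [P [d' [uP /realmx_map[d ->{d'}] PW PK]]] := posdef_codiag hK hW pW.
(* The roots are the diagonal entries of [K] in a basis where [W] is the identity. *)
pose t := [seq d 0 i | i : 'I_n]; exists (sort <=%R t); last first.
  by rewrite size_sort size_map size_enum_ord.
(* The diagonalizing matrix [Q] varies with [x], but the modulus of its determinant does not. Nor do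
   the product and the number of negative values among the pivot eigenvalues [e]. *)
have diagL x : exists (Q : 'M[C]_(p + n)) (e : 'rV[C]_p),
    [/\ Q \in unitmx /\ e \is a realmx,
        \det Q * (\det Q)^* = \det P * (\det P)^*,
        \prod_i e 0 i = beta, (\sum_i (e 0 i < 0)%R)%N = j &
        Q *m L x *m Q^t* =
          diag_mx (row_mx e (map_mx (real_complex R) (d - const_mx x)))].
  have hB : (ulsubmx (L x))^t* = ulsubmx (L x).
    by rewrite trmx_ulsub map_ulsubmx hL.
  have [U [e [uU re eU]]] := herm_spectral hB.
  pose T : 'M[C]_(p + n) := block_mx 1%:M 0 (- Y x) 1%:M.
  have dT : \det T = 1 by rewrite det_lblock !det1 mulr1.
  pose V : 'M[C]_(p + n) := block_mx U 0 0 P.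
  have dV : \det V = \det U * \det P by rewrite det_ublock.
  exists (V *m T), e; split => //.
  - by split=> //; rewrite unitmxE det_mulmx dT dV mulr1 unitrM -!unitmxE uP unitarymx_unit.
  - rewrite det_mulmx dT dV mulr1 rmorphM /= mulrACA -!det_trmxC -[X in X * _]det_mulmx.
    by rewrite (unitarymxP uU) det1 mul1r.
  - by rewrite -det_diag -eU det_unitary_congr.
  - apply/eqP; rewrite eqn_leq.
    have E k : has_neg (ulsubmx (L x)) k <-> (k <= \sum_i (e 0 i < 0)%R)%N.
      by rewrite -(has_neg_diag _ re) -eU has_neg_congr_unit ?unitarymx_unit.
    by apply/andP; split; [apply/hneg/E | apply/E/hneg].
  rewrite congr_mulmx schur_congr // hM.
  rewrite tr_block_mx map_block_mx !trmx0 !map_mx0 !mulmx_block.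
  rewrite !mulmx0 !mul0mx !addr0 !add0r !mul0mx.
  rewrite eU mulmxBr mulmxBl PK -scalemxAr -scalemxAl PW.
  rewrite diag_mx_row; congr block_mx.
  by apply/matrixP => a b; rewrite !mxE rmorphB /= mulrnBl mulr_natr.
have countE x : count (< x) (sort <=%R t) = (\sum_i (d 0 i < x)%R)%N.
  rewrite (permP (permEl (perm_sort _ _))) count_map -sum1_count big_enum_cond /=.
  by rewrite big_mkcond /=; apply: eq_bigr => i _; case: (_ < _).
split.
- exact: (sort_sorted (@le_total _ R)).
- pose kP := \det P * (\det P)^*.
  have kP0 : kP != 0 by rewrite mulf_neq0 ?fmorph_eq0 // -unitfE -unitmxE.
  (* The sign turns the factors [d 0 i - x] into [x - d 0 i]. *)
  exists (beta / kP * (-1) ^+ n) => [|x].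
    by rewrite !mulf_neq0 ?invr_eq0 // signr_eq0.
  have [Q [e [[uQ re] dQ de _ eQ]]] := diagL x.
  have : \det (L x) * kP = beta * \prod_i Cr (d 0 i - x).
    rewrite /kP -dQ -det_trmxC mulrCA mulrA -!det_mulmx eQ det_diag big_split_ord /= -de.
    congr (_ * _); apply: eq_bigr => i _; first by rewrite row_mxEl.
    by rewrite row_mxEr !mxE.
  move/(canRL (mulfK kP0)) ->.
  rewrite (perm_big _ (permEl (perm_sort _ _))) /= big_map big_enum /=.
  under eq_bigr do rewrite -opprB rmorphN.
  by rewrite prodrN card_ord; ring.
- move=> x k; rewrite countE.
  have [Q [e [[uQ re] _ _ <- eQ]]] := diagL x.
  rewrite -(has_neg_congr_unit _ _ uQ) eQ has_neg_diag; last first.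
    apply/mxOverP => a b; rewrite mxE; case: split => c; first exact: (mxOverP re).
    by rewrite mxE; apply/complex_realP; eexists.
  rewrite big_split_ord /= (eq_bigr (fun i => (e 0 i < 0)%R : nat)) => [|i _]; last first.
    by rewrite row_mxEl.
  rewrite [X in (_ + X)%N](eq_bigr (fun i => (d 0 i < x)%R : nat)) // => i _.
  by rewrite row_mxEr !mxE (ltcR _ 0) subr_lt0.
Qed.

End Pencil.

(** * Pencils with an empty, a nonzero or a vanishing pivot *)

Section Cases.
Variable R : rcfType.
Local Notation C := (R[i]).
Local Notation Cr x := (real_complex R x).

Definition rdiag m (om : 'rV[R]_m) : 'M[C]_m := diag_mx (map_mx (real_complex R) om).
Definition pencil m (H : 'M[C]_m) (om : 'rV[R]_m) (x : R) : 'M[C]_m :=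
  H - Cr x *: rdiag om.

Lemma conjCr (x : R) : (Cr x)^* = Cr x.
Proof. by apply/CrealP/complex_realP; exists x. Qed.

Lemma det_mx2 (F : comPzRingType) (A : 'M[F]_2) : \det A = A 0 0 * A 1 1 - A 0 1 * A 1 0.
Proof.
rewrite (expand_det_row _ 0) !big_ord_recl big_ord0 /cofactor !det_mx11 !mxE /=.
have -> : lift 0 0 = 1 :> 'I_2 by apply: val_inj.
have -> : lift 1 0 = 0 :> 'I_2 by apply: val_inj.
by rewrite !expr0 expr1; ring.
Qed.

Lemma rdiagE m (om : 'rV[R]_m) i j : rdiag om i j = Cr (om 0 i) *+ (i == j).
Proof. by rewrite !mxE. Qed.

Lemma pencilE m H (om : 'rV[R]_m) x i j :
  pencil H om x i j = H i j - Cr (x * om 0 i) *+ (i == j).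
Proof. by rewrite !mxE mulrnAr -rmorphM. Qed.

Lemma rdiag_herm m (om : 'rV[R]_m) : (rdiag om)^t* = rdiag om.
Proof.
rewrite /rdiag tr_diag_mx map_diag_mx; congr diag_mx.
by apply/rowP => i; rewrite !mxE /= conjCr.
Qed.

Lemma pencil_herm m (H : 'M[C]_m) (om : 'rV[R]_m) x :
  H^t* = H -> (pencil H om x)^t* = pencil H om x.
Proof.
move=> hH; rewrite /pencil linearB linearZ /= map_mxB hH map_mxZ rdiag_herm.
by rewrite /= conjCr.
Qed.

Lemma herm_entry m (H : 'M[C]_m) i j : H^t* = H -> (H i j)^* = H j i.
Proof. by move=> hH; rewrite -{2}hH !mxE. Qed.

Lemma posdef_rdiag m (om : 'rV[R]_m) : (forall i, 0 < om 0 i) -> posdef (rdiag om).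
Proof. by move=> h; apply: posdef_diag => i; rewrite mxE (ltcR 0). Qed.

Lemma pencil_drsub p n (H : 'M[C]_(p + n)) (om : 'rV[R]_(p + n)) x :
  drsubmx (pencil H om x) = drsubmx H - Cr x *: rdiag (rsubmx om).
Proof. by apply/matrixP => i j; rewrite !mxE eq_rshift. Qed.

Lemma pencil_ursub p n (H : 'M[C]_(p + n)) (om : 'rV[R]_(p + n)) x :
  ursubmx (pencil H om x) = ursubmx H.
Proof. by apply/matrixP => i j; rewrite !mxE eq_lrshift mulr0n mulr0 subr0. Qed.

Lemma pencil_dlsub p n (H : 'M[C]_(p + n)) (om : 'rV[R]_(p + n)) x :
  dlsubmx (pencil H om x) = dlsubmx H.
Proof. by apply/matrixP => i j; rewrite !mxE eq_rlshift mulr0n mulr0 subr0. Qed.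

Lemma pencil_definite m (K : 'M[C]_m) (om : 'rV[R]_m) : K^t* = K -> (forall i, 0 < om 0 i) ->
  exists2 s, pencil_spec (pencil K om) 0 s & size s = m.
Proof.
move=> hK h.
apply: (@pencil_schur R 0 m _ (fun=> 0) K (rdiag om) 1) => //.
- by move=> x; apply: pencil_herm.
- by move=> x; apply/matrixP => i [].
- move=> x; rewrite mul0mx subr0; apply/matrixP => i j; rewrite !mxE.
  by have [-> ->] : rshift 0 i = i /\ rshift 0 j = j by split; apply: val_inj.
- exact: rdiag_herm.
- exact: posdef_rdiag.
- exact: oner_neq0.
- by move=> x; rewrite det_mx00.
- by move=> x k; apply: has_neg_mx00.
Qed.

(** As the weight vanishes at index 0, the pivot [H 0 0] is free of [x]. Its Schur complement
    changes [H] by a constant matrix and keeps the other weights, and the pivot adds a negative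
    direction exactly when it is negative. *)
Lemma pencil_nonzero m (H : 'M[C]_(1 + m)) (om : 'rV[R]_(1 + m)) : H^t* = H -> H 0 0 != 0 ->
  om 0 0 = 0 -> (forall i, i != 0 -> 0 < om 0 i) ->
  exists2 s, pencil_spec (pencil H om) (H 0 0 < 0)%R s & size s = m.
Proof.
move=> hH c0 om0 h; set c := H 0 0.
have cc : c^* = c by rewrite herm_entry.
have rc : c \is Num.real by apply/CrealP.
pose Y := c^-1 *: dlsubmx H.
have hur : (ursubmx H)^t* = dlsubmx H by rewrite trmx_ursub map_dlsubmx hH.
have l0 : lshift m (0 : 'I_1) = 0 by apply: val_inj.
have ulE x : ulsubmx (pencil H om x) 0 0 = c.
  by rewrite [LHS]mxE [LHS]mxE l0 pencilE om0 mulr0 mul0rn subr0.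
apply: (@pencil_schur R 1 m _ (fun=> Y) (drsubmx H - Y *m ursubmx H)
  (rdiag (rsubmx om)) c).
- by move=> x; apply: pencil_herm.
- move=> x; apply/matrixP => i j; rewrite [j]ord1 [LHS]mxE big_ord1 ulE.
  rewrite !mxE eq_rlshift mulr0n mulr0 subr0 l0 mulrC mulrA mulfV // mul1r //.
- move=> x; rewrite pencil_drsub pencil_ursub; exact: addrAC.
- rewrite linearB /= map_mxB -scalemxAl linearZ /= map_mxZ trmxC_mul hur.
  have -> : (dlsubmx H)^t* = ursubmx H by rewrite -hur trmxCK.
  rewrite /= fmorphV /= cc; congr (_ - _).
  by rewrite trmx_drsub map_drsubmx hH.
- exact: rdiag_herm.
- by apply: posdef_rdiag => i; rewrite mxE h.
- by [].
- by move=> x; rewrite det_mx11 ulE.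
- by move=> x k; rewrite has_neg_mx11 ulE.
Qed.

(* Although the pivot block [0, c^*; c, H_11 - x om_1] depends on x, its determinant does
   not, and its Schur complement is still affine in x: W gains a positive semidefinite
   rank-one term. *)
Lemma pencil_zero n (H : 'M[C]_(2 + n)) (om : 'rV[R]_(2 + n)) :
  H^t* = H -> H 0 0 = 0 -> H 1 0 != 0 ->
  om 0 0 = 0 -> (forall i, i != 0 -> 0 < om 0 i) ->
  exists2 s, pencil_spec (pencil H om) 1 s & size s = n.
Proof.
move=> hH H00 h0 om0 h; set c := H 1 0 in h0.
pose g : 'cV[C]_n := \col_i H (rshift 2 i) 0.
pose b : 'cV[C]_n := \col_i H (rshift 2 i) 1.
pose al x := H 1 1 - Cr (x * om 0 1).
(* [Y x] times the pivot block must have columns [g] and [b]: the first equation determines column 1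
   of [Y x], the second then column 0. *)
pose Y x : 'M[C]_(n, 2) := \matrix_(i, j)
  if j == 0 then (b i 0 - g i 0 * al x / c) / c^* else g i 0 / c.
have cc0 : c^* != 0 by rewrite fmorph_eq0.
have l0 : lshift n (0 : 'I_2) = 0 by apply: val_inj.
have l1 : lshift n (1 : 'I_2) = 1 by apply: val_inj.
have H01 : H 0 1 = c^* by rewrite herm_entry.
have P00 x : pencil H om x 0 0 = 0 by rewrite pencilE om0 mulr0 mul0rn subr0.
have P01 x : pencil H om x 0 1 = c^* by rewrite pencilE subr0.
have P10 x : pencil H om x 1 0 = c by rewrite pencilE subr0.
have P11 x : pencil H om x 1 1 = al x by rewrite pencilE.
have al_real : (H 1 1)^* = H 1 1 by rewrite herm_entry.
(* [K] and [W] come from sorting the Schur complement by powers of [x]; the rank-one term of [W] is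
   the part of [g al(x) g^* / |c|^2] linear in [x]. *)
pose K : 'M[C]_n := \matrix_(i, j) (H (rshift 2 i) (rshift 2 j)
  - ((b i 0 - g i 0 * H 1 1 / c) / c^* * (g j 0)^* + g i 0 / c * (b j 0)^*)).
pose W : 'M[C]_n := rdiag (rsubmx om) + (Cr (om 0 1) / (c * c^*)) *: (g *m g^t*).
have om1 : 0 < om 0 1 by apply: h.
have detB x : \det (ulsubmx (pencil H om x)) = - (c * c^*).
  rewrite det_mx2.
  have E i j : ulsubmx (pencil H om x) i j = pencil H om x (lshift n i) (lshift n j).
    by rewrite [LHS]mxE [LHS]mxE.
  by rewrite !E l0 l1 P00 P01 P10 mul0r sub0r mulrC.
apply: (@pencil_schur R 2 n _ Y K W (- (c * c^*))).
- by move=> x; apply: pencil_herm.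
- move=> x; apply/matrixP => i j; rewrite [LHS]mxE !big_ord_recl big_ord0.
  rewrite [Y x _ _]mxE [Y x i (lift _ _)]mxE.
  have -> : lift ord0 ord0 = 1 :> 'I_2 by apply: val_inj.
  have [-> ->] : ulsubmx (pencil H om x) ord0 j = pencil H om x 0 (lshift n j) /\
           ulsubmx (pencil H om x) 1 j = pencil H om x 1 (lshift n j).
    by rewrite -l0 -l1; split; rewrite [LHS]mxE [LHS]mxE.
  rewrite pencil_dlsub [RHS]mxE [RHS]mxE /=.
  have [->|j1] : j = 0 \/ j = 1.
    by case: j => [[|[]]] //= ?; [left | right]; apply: val_inj.
    rewrite l0 P00 P10 !mxE; field.
    by rewrite h0.
  rewrite j1 l1 P01 P11 !mxE; field.
  by rewrite h0.
- move=> x; rewrite pencil_drsub pencil_ursub; apply/matrixP => i j.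
  rewrite [LHS]mxE [X in X + _]mxE [X in _ + X]mxE [X in _ - X]mxE !big_ord_recl big_ord0.
  have -> : lift ord0 ord0 = 1 :> 'I_2 by apply: val_inj.
  have -> : ursubmx H ord0 j = (g j 0)^*.
    by rewrite [LHS]mxE [LHS]mxE l0 mxE herm_entry.
  have -> : ursubmx H 1 j = (b j 0)^*.
    by rewrite [LHS]mxE [LHS]mxE l1 mxE herm_entry.
  have -> : drsubmx H i j = H (rshift 2 i) (rshift 2 j) by rewrite [LHS]mxE [LHS]mxE.
  have -> : (K - Cr x *: W) i j = K i j - (Cr x * rdiag (rsubmx om) i j
      + Cr x * (Cr (om 0 1) / (c * c^*) * (g i 0 * (g j 0)^*))).
    by rewrite mxE [in X in _ + X]mxE [in X in _ - X]mxE [W i j]mxE [in X in _ - _ * (_ + X)]mxE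
       [(g *m _) i j]mxE big_ord1 [_ 0 j]mxE [_ 0 j]mxE mulrDr.
  rewrite [X in _ + X - _]mxE [X in _ - X - _]mxE [K i j]mxE [Y x i ord0]mxE.
  rewrite [Y x i 1]mxE /= /al rmorphM.
  set G1 := g i 0; set G2 := (g j 0)^*; set B1 := b i 0; set B2 := (b j 0)^*.
  by field; rewrite ?fmorph_eq0 h0.
- apply/matrixP => i j; rewrite [LHS]mxE [K^T i j]mxE [K j i]mxE [K i j]mxE.
  rewrite /= !(rmorphB, rmorphD, rmorphM, fmorphV) /= !conjCK herm_entry //.
  rewrite al_real; set G1 := g i 0; set G2 := (g j 0)^*; set B1 := b i 0; set B2 := (b j 0)^*.
  by field; rewrite ?fmorph_eq0 h0.
- rewrite /W linearD linearZ /= map_mxD map_mxZ rdiag_herm trmxC_mul trmxCK.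
  congr (_ + _ *: _).
  by rewrite /= !(rmorphM, fmorphV) /= conjCK conjCr [c^* * _]mulrC.
- move=> u u0; rewrite hformD hformZ hform_mulC ltr_pwDl //.
    by apply: posdef_rdiag => // i; rewrite mxE h.
  by rewrite mulr_ge0 ?exprn_ge0 // -normCK divr_ge0 ?exprn_ge0 // (lecR 0) ltW.
- by rewrite oppr_eq0 mulf_neq0.
- exact: detB.
- move=> x k; apply: has_neg_det2.
    by rewrite trmx_ulsub map_ulsubmx pencil_herm.
  by rewrite detB oppr_lt0 -normCK exprn_gt0 ?normr_gt0.
Qed.

End Cases.

(** * Reduction of the Sturm-Liouville problem to a pencil *)

Lemma det_single_row (F : comPzRingType) n (A : 'M[F]_n) i j :
  (forall k, k != j -> A i k = 0) ->
  \det A = A i j * ((-1) ^+ (i + j) * \det (row' i (col' j A))).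
Proof.
move=> h; rewrite (expand_det_row _ i) (bigD1 j) //= big1 ?addr0 //.
by move=> k /h ->; rewrite mul0r.
Qed.

Lemma det_single_col (F : comPzRingType) n (A : 'M[F]_n) i j :
  (forall k, k != i -> A k j = 0) ->
  \det A = A i j * ((-1) ^+ (i + j) * \det (row' i (col' j A))).
Proof.
move=> h; rewrite (expand_det_col _ j) (bigD1 i) //= big1 ?addr0 //.
by move=> k /h ->; rewrite mul0r.
Qed.

(** The row operation is left multiplication by [1 + delta_mx i j], which is lower triangular with
    unit diagonal because [j < i]. *)
Lemma det_add_row (F : comPzRingType) n (A : 'M[F]_n) (i j : 'I_n) : (j < i)%N ->
  \det (\matrix_(k, l) (A k l + A j l *+ (k == i))) = \det A.
Proof.
move=> ji; pose E : 'M[F]_n := 1%:M + delta_mx i j.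
have trigE : is_trig_mx E.
  apply/is_trig_mxP => a b ab; rewrite !mxE.
  have -> : (a == b) = false by apply/negbTE; rewrite -val_eqE /=; lia.
  rewrite add0r; case: andP => // -[/eqP ? /eqP ?]; subst; lia.
have dE : \det E = 1.
  rewrite det_trig // big1 // => k _; rewrite !mxE eqxx.
  case: andP => [[/eqP -> /eqP]|]; last by rewrite addr0.
  by move=> h; rewrite h ltnn in ji.
rewrite -[RHS]mul1r -dE -det_mulmx; congr (\det _); apply/matrixP => k l.
rewrite [LHS]mxE /E mulmxDl mul1mx [RHS]mxE; congr (_ + _).
rewrite [RHS]mxE (bigD1 j) //= big1 ?addr0 => [|m /negPf mj]; last first.
  by rewrite mxE mj andbF mul0r.
by rewrite mxE eqxx andbT; case: (k == i); rewrite ?mul1r ?mul0r.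
Qed.

Section Reduction.
Variable R : rcfType.
Local Notation C := (R[i]).
Local Notation Cr x := (real_complex R x).
Variables (N : nat) (f q w : nat -> R).
Hypothesis N2 : (2 <= N)%N.

(* Rows 0 and N absorb the boundary condition [bcA_A a z | bcA_B b z]. *)
Definition sl_coef (a b : R) (z : C) (i j : nat) : C :=
  Cr (if i == 0 then a + f 0 else f i.-1 + q i + (if i == N then b else f i)) *+ (i == j)
  - Cr (f i) *+ (j == i.+1) - Cr (f j) *+ (i == j.+1)
  + z^* *+ ((i == 0) && (j == N)) + z *+ ((i == N) && (j == 0)).

Definition sl_weight (i : nat) : R := if i == 0 then 0 else w i.

(** Entries of the system at a real parameter, indexed by natural numbers so that identities reduce
    to comparing indices. Row [i >= 2] is the difference equation at [i.-1]. *)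
Definition sl_eval (A B : 'M[C]_2) (x : R) (i j : nat) : C :=
  if (i < 2)%N then
    let k : 'I_2 := inord i in
      ((j == 0)%N)%:R * (A k ord0 - A k (inord 1) * Cr (f 0%N))
       + ((j == 1)%N)%:R * (A k (inord 1) * Cr (f 0%N))
       + ((j == N)%N)%:R * (B k ord0 - B k (inord 1) * Cr (f N))
       + ((j == N.+1)%N)%:R * (B k (inord 1) * Cr (f N))
  else
      ((j == i)%N)%:R * (- Cr (f i.-1))
       + ((j == i.-1)%N)%:R * (Cr (f i.-1 + f i.-2 + q i.-1) - Cr (w i.-1) * Cr x)
       + ((j == i.-2)%N)%:R * (- Cr (f i.-2)).

Lemma sl_charpolyE A B x : (sl_charpoly N f q w A B).[Cr x] =
  \det (\matrix_(i < N.+2, j < N.+2) sl_eval A B x i j).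
Proof.
rewrite /sl_charpoly -[_.[_]]/(horner_eval (Cr x) _) -det_map_mx; congr (\det _).
apply/matrixP => i j; rewrite !mxE /= /sl_eval /horner_eval.
case: ifP => [i2|/negbT i2]; first by rewrite /= hornerC.
have -> : i.-1.+1 = i by lia.
by rewrite !(hornerE, hornerMn).
Qed.

Lemma inord2_0 : (inord 0 : 'I_2) = 0. Proof. by apply: val_inj; rewrite /= inordK. Qed.
Lemma inord2_1 : (inord 1 : 'I_2) = 1. Proof. by apply: val_inj; rewrite /= inordK. Qed.

Ltac case_nat_eqs := repeat (case: eqP => /= ?; try (exfalso; lia));
  rewrite ?(mul0r, mul1r, mulr0n, mulr1n);
  repeat match goal with H : S _ = S _ |- _ => apply succn_inj in H end; subst.

Lemma sl_eval_diff A B x i j : (2 <= i)%N -> sl_eval A B x i j =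
  - Cr (f i.-1) *+ (j == i)
  + (Cr (f i.-1 + f i.-2 + q i.-1) - Cr (w i.-1 * x)) *+ (j == i.-1)
  - Cr (f i.-2) *+ (j == i.-2).
Proof.
move=> i2; rewrite /sl_eval ifF; last by lia.
by rewrite rmorphM /=; case_nat_eqs; ring.
Qed.

Lemma sl_eval_bcA0 a b z x j : sl_eval (bcA_A a z) (bcA_B b z) x 0 j =
  Cr (a + f 0) *+ (j == 0%N) - Cr (f 0) *+ (j == 1%N) + z^* *+ (j == N).
Proof.
rewrite /sl_eval /= inord2_0 inord2_1 !mxE /= rmorphD /=.
by case_nat_eqs; ring.
Qed.

Lemma sl_eval_bcA1 a b z x j : sl_eval (bcA_A a z) (bcA_B b z) x 1 j =
  z *+ (j == 0%N) + Cr (b - f N) *+ (j == N) + Cr (f N) *+ (j == N.+1).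
Proof.
rewrite /sl_eval /= inord2_1 !mxE /= rmorphB /=.
by case_nat_eqs; ring.
Qed.

Lemma sl_eval_bcS30 b x j : sl_eval (bcS3_A R) (bcS3_B b) x 0 j = (j == 0%N)%:R.
Proof.
rewrite /sl_eval /= inord2_0 inord2_1 !mxE /=.
by case_nat_eqs; ring.
Qed.

Lemma sl_eval_bcS31 b x j : sl_eval (bcS3_A R) (bcS3_B b) x 1 j =
  Cr (b - f N) *+ (j == N) + Cr (f N) *+ (j == N.+1).
Proof.
rewrite /sl_eval /= inord2_1 !mxE /= rmorphB /=.
by case_nat_eqs; ring.
Qed.

Lemma sl_eval_bcS40 a x j : sl_eval (bcS4_A a) (bcS4_B R) x 0 j =
  Cr (a + f 0) *+ (j == 0%N) - Cr (f 0) *+ (j == 1%N).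
Proof.
rewrite /sl_eval /= inord2_0 inord2_1 !mxE /= rmorphD /=.
by case_nat_eqs; ring.
Qed.

Lemma sl_eval_bcS41 a x j : sl_eval (bcS4_A a) (bcS4_B R) x 1 j = (j == N)%:R.
Proof.
rewrite /sl_eval /= inord2_1 !mxE /=.
by case_nat_eqs; ring.
Qed.

Definition sl_mxA a b z := \matrix_(i < N.+1, j < N.+1) sl_coef a b z i j.
Definition sl_wA := \row_(i < N.+1) sl_weight i.

(** [S_3] forces y_0 = 0 and leaves the indices 1..N, while [S_4] forces y_N = 0 and leaves 0..N-1.
    The zero arguments stand for parameters located in the deleted row or column. *)
Definition sl_mxS3 b := \matrix_(i < N, j < N) sl_coef 0 b 0 i.+1 j.+1.
Definition sl_wS3 := \row_(i < N) sl_weight i.+1.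
Definition sl_mxS4 a := \matrix_(i < N, j < N) sl_coef a 0 0 i j.
Definition sl_wS4 := \row_(i < N) sl_weight i.

Lemma pencil_coefE m a b z (u : nat -> nat) x (i j : 'I_m) : injective u ->
  pencil (\matrix_(i, j) sl_coef a b z (u i) (u j)) (\row_i sl_weight (u i)) x i j =
  sl_coef a b z (u i) (u j) - Cr (sl_weight (u i) * x) *+ (u i == u j).
Proof. by move=> iu; rewrite pencilE !mxE (inj_eq iu) val_eqE [x * _]mulrC. Qed.

(** [bump 1] skips row 1, the second boundary equation, which is added to the difference equation at
    N. The terms in y_(N+1) cancel, and [- f N] and [f N] cancel in the coefficient of y_N, leaving
    [b]. *)
Lemma sl_eval_minorA a b z x i j : (i <= N)%N -> (j <= N)%N ->
  sl_eval (bcA_A a z) (bcA_B b z) x (bump 1 i) j +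
  sl_eval (bcA_A a z) (bcA_B b z) x 1 j *+ (bump 1 i == N.+1) =
  sl_coef a b z i j - Cr (sl_weight i * x) *+ (i == j).
Proof.
move=> iN jN; case: i iN => [|i] iN.
  rewrite /bump /= addn0 sl_eval_bcA0 /sl_coef /sl_weight /= mul0r.
  by case_nat_eqs; ring.
rewrite /bump /= sl_eval_diff // sl_eval_bcA1 /sl_coef /sl_weight /=.
case_nat_eqs; rewrite ?(rmorphD, rmorphN, rmorphM) /=; ring.
Qed.

Lemma sl_eval_minorS3 b x i j : (i < N)%N -> (j < N)%N ->
  sl_eval (bcS3_A R) (bcS3_B b) x i.+2 j.+1 +
  sl_eval (bcS3_A R) (bcS3_B b) x 1 j.+1 *+ (i.+2 == N.+1) =
  sl_coef 0 b 0 i.+1 j.+1 - Cr (sl_weight i.+1 * x) *+ (i.+1 == j.+1).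
Proof.
move=> iN jN; rewrite sl_eval_diff // sl_eval_bcS31 /sl_coef /sl_weight /=.
case_nat_eqs; rewrite ?(rmorphD, rmorphN, rmorphM) /=; ring.
Qed.

Lemma sl_eval_minorS4 a x i j : (i < N)%N -> (j < N)%N ->
  sl_eval (bcS4_A a) (bcS4_B R) x (bump 1 i) j =
  sl_coef a 0 0 i j - Cr (sl_weight i * x) *+ (i == j).
Proof.
move=> iN jN; case: i iN => [|i] iN.
  rewrite /bump /= addn0 sl_eval_bcS40 /sl_coef /sl_weight /= mul0r.
  by case_nat_eqs; ring.
rewrite /bump /= sl_eval_diff // /sl_coef /sl_weight /=.
case_nat_eqs; rewrite ?(rmorphD, rmorphN, rmorphM) /=; ring.
Qed.

Let o1 : 'I_N.+2 := lift ord0 ord0.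

(** Adding row 1 to the last row leaves row 1 as the only one involving y_(N+1); the determinant is
    then expanded along the last column. *)
Lemma det_last_col (M : nat -> nat -> C) :
  (forall i, (i < N.+2)%N -> i != 1%N -> M i N.+1 + M 1%N N.+1 *+ (i == N.+1) = 0) ->
  \det (\matrix_(i < N.+2, j < N.+2) M i j) =
  M 1%N N.+1 * ((-1) ^+ N.+2 *
    \det (\matrix_(i < N.+1, j < N.+1) (M (bump 1 i) j + M 1%N j *+ (bump 1 i == N.+1)))).
Proof.
move=> h; rewrite -(@det_add_row _ _ _ ord_max o1); last by rewrite /= /bump /=; lia.
rewrite (@det_single_col _ _ _ o1 ord_max) => [|k ko]; last first.
  by rewrite !mxE -[k == _]val_eqE /= /bump /= h // -[k == _]val_eqE.
congr (_ * (_ * _)).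
  by rewrite !mxE -val_eqE /= /bump /=; case: eqP => [|_]; [lia | rewrite mulr0n addr0].
apply: (congr1 (fun A : 'M[C]_N.+1 => \det A)).
apply/matrixP => i j; rewrite !mxE -val_eqE /= /bump /=.
by have -> : (N < j)%N = false by apply/negbTE; rewrite -leqNgt -ltnS.
Qed.

Lemma det_bcA a b z x :
  \det (\matrix_(i < N.+2, j < N.+2) sl_eval (bcA_A a z) (bcA_B b z) x i j) =
  Cr (f N) * (-1) ^+ N.+2 * \det (pencil (sl_mxA a b z) sl_wA x).
Proof.
rewrite det_last_col => [|i iN i1]; last first.
  rewrite sl_eval_bcA1; case: i iN i1 => [|[|i]] // iN _.
    by rewrite sl_eval_bcA0; case_nat_eqs; ring.
  by rewrite sl_eval_diff //=; case_nat_eqs; ring.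
rewrite mulrA; congr (_ * _ * _).
  by rewrite sl_eval_bcA1; case_nat_eqs; ring.
apply: (congr1 (fun A : 'M[C]_N.+1 => \det A)).
apply/matrixP => i j; rewrite (pencil_coefE a b z x _ _ (@inj_id nat)) mxE.
by rewrite sl_eval_minorA // -ltnS.
Qed.

Lemma det_bcS3 b x :
  \det (\matrix_(i < N.+2, j < N.+2) sl_eval (bcS3_A R) (bcS3_B b) x i j) =
  Cr (f N) * (-1) ^+ N.+2 * \det (pencil (sl_mxS3 b) sl_wS3 x).
Proof.
rewrite det_last_col => [|i iN i1]; last first.
  rewrite sl_eval_bcS31; case: i iN i1 => [|[|i]] // iN _.
    by rewrite sl_eval_bcS30; case_nat_eqs; ring.
  by rewrite sl_eval_diff //=; case_nat_eqs; ring.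
rewrite mulrA; congr (_ * _ * _).
  by rewrite sl_eval_bcS31; case_nat_eqs; ring.
(* The remaining first row reads y_0 = 0, so row and column 0 split off. *)
rewrite (@det_single_row _ _ _ ord0 ord0) => [|k]; last first.
  by rewrite mxE -val_eqE /= /bump /= addn0 sl_eval_bcS30 => /negPf ->; rewrite addr0.
rewrite mxE /= /bump /= addn0 sl_eval_bcS30 expr0 !mul1r.
rewrite mulr0n addr0 mul1r; apply: (congr1 (fun A : 'M[C]_N => \det A)).
apply/matrixP => i j; rewrite (pencil_coefE 0 b 0 x _ _ succn_inj) !mxE.
by rewrite -sl_eval_minorS3.
Qed.

(** Row 1 reads y_N = 0 and removes column N. Then y_(N+1) occurs only in the difference equation at
    N, with coefficient [- f N], and a second expansion removes both. *)
Lemma det_bcS4 a x :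
  \det (\matrix_(i < N.+2, j < N.+2) sl_eval (bcS4_A a) (bcS4_B R) x i j) =
  (-1) ^+ N.+1 * (- Cr (f N) * (-1) ^+ (N + N)) * \det (pencil (sl_mxS4 a) sl_wS4 x).
Proof.
pose oN : 'I_N.+2 := Ordinal (leqnSn N.+1).
rewrite (@det_single_row _ _ _ o1 oN) => [|k]; last first.
  by rewrite mxE -val_eqE /= sl_eval_bcS41; case: eqP.
rewrite mxE sl_eval_bcS41 eqxx mul1r -!mulrA; congr (_ * _).
rewrite (@det_single_col _ _ _ ord_max ord_max) => [|k]; last first.
  rewrite !mxE -val_eqE /= /bump /= leqnn.
  case: k => [[|k] kN] /= kN'.
    by rewrite addn0 sl_eval_bcS40; case_nat_eqs; ring.
  by rewrite sl_eval_diff //=; case_nat_eqs; ring.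
congr (_ * (_ * _)).
  rewrite !mxE /= /bump /= leqnn; have -> : (0 < N)%N by lia.
  by rewrite sl_eval_diff //=; [case_nat_eqs; ring | lia].
apply: (congr1 (fun A : 'M[C]_N => \det A)).
apply/matrixP => i j; rewrite (pencil_coefE a 0 0 x _ _ (@inj_id nat)) !mxE.
rewrite -sl_eval_minorS4 //=; congr (sl_eval _ _ _ (bump 1 _) _).
  by rewrite /bump leqNgt ltn_ord.
by have := ltn_ord j; rewrite /bump /=; lia.
Qed.

End Reduction.

(** * Eigenvalue lists *)

Section Eigenlist.
Variable R : rcfType.
Local Notation C := (R[i]).
Local Notation Cr x := (real_complex R x).

(** The difference vanishes at as many natural numbers as its size. *)
Lemma poly_eq_real (p r : {poly C}) : (forall x : R, p.[Cr x] = r.[Cr x]) -> p = r.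
Proof.
move=> h; apply/eqP; rewrite -subr_eq0; apply/eqP.
apply: (@roots_geq_poly_eq0 _ _ [seq Cr n%:R | n <- iota 0 (size (p - r))]).
- by apply/allP => _ /mapP[n _ ->]; rewrite rootE hornerD hornerN h subrr.
- rewrite map_inj_uniq ?iota_uniq // => m n /complexI /eqP.
  by rewrite eqr_nat => /eqP.
- by rewrite size_map size_iota.
Qed.

Lemma mup_prod_XsubC (x : C) (s : seq C) :
  mup x (\prod_(y <- s) ('X - y%:P)) = count_mem x s.
Proof.
elim: s => [|y s IH]; first by rewrite big_nil mupNroot // rootE hornerC oner_eq0.
have nz : \prod_(y <- s) ('X - y%:P) != 0 :> {poly C}.
  by rewrite monic_neq0 // monic_prod_XsubC.
rewrite big_cons mupM ?polyXsubC_eq0 // IH /=.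
by rewrite -['X - _]expr1 mup_XsubCX; case: eqP.
Qed.

(** Agreement at real arguments already determines the characteristic polynomial, which therefore
    splits over the real list [s]: this gives reality of all eigenvalues and their multiplicities at
    once. *)
Lemma sl_eigenlist_pencil N f q w A B m (L : R -> 'M[C]_m) (sigma : C) j s :
  sigma != 0 -> (forall x, (sl_charpoly N f q w A B).[Cr x] = sigma * \det (L x)) ->
  pencil_spec L j s -> sl_eigenlist N f q w A B s.
Proof.
move=> sig0 hp [ss [kappa kap0 hdet] _].
have E : sl_charpoly N f q w A B =
    (sigma * kappa)%:P * \prod_(y <- [seq Cr x | x <- s]) ('X - y%:P).
  apply: poly_eq_real => x; rewrite hp hdet hornerM hornerC -mulrA; congr (_ * (_ * _)).
  rewrite big_map horner_prod; apply: eq_bigr => y _.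
  by rewrite hornerXsubC rmorphB.
have nz : (sigma * kappa)%:P != 0 :> {poly C} by rewrite polyC_eq0 mulf_neq0.
split=> //; first by rewrite E mulf_neq0 // monic_neq0 // monic_prod_XsubC.
move=> lam; rewrite /sl_mult E mupMr ?mup_prod_XsubC //.
by rewrite rootE hornerC mulf_neq0.
Qed.

(** Allows an arbitrary given eigenvalue list to be replaced by the one constructed from the
    pencil. *)
Lemma sl_eigenlist_inj N f q w A B (s t : seq R) :
  sl_eigenlist N f q w A B s -> sl_eigenlist N f q w A B t -> s = t.
Proof.
move=> [_ ss hs] [_ st ht]; apply: (sorted_eq le_trans le_anti ss st).
apply/allP => x _ /=; have := hs (Cr x); rewrite ht !count_map => E.
by rewrite -!(eq_count (a1 := preim (fun y => Cr y) (pred1 (Cr x)))) ?E //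
  => y /=; rewrite (inj_eq (@complexI R)).
Qed.

Lemma pencil_spec_count m n (L : R -> 'M[C]_m) (M : R -> 'M[C]_n) j l s t i :
  (forall x k, has_neg (L x) (i + k) -> has_neg (M x) k) ->
  pencil_spec L j s -> pencil_spec M l t ->
  forall x, (j + count (< x) s <= i + (l + count (< x) t))%N.
Proof.
move=> h [_ _ hs] [_ _ ht] x; rewrite leqNgt; apply/negP => lt_c.
have /hs/h/ht : (i + (l + count (< x) t).+1 <= j + count (< x) s)%N by rewrite addnS.
by rewrite ltnn.
Qed.

(** At [x] equal to the [n]-th entry of [t], at most [n] entries of [t] lie below [x], hence at most
    [i + n] entries of [s]. *)
Lemma nth_le_of_count (s t : seq R) i n : sorted <=%R s -> sorted <=%R t ->
  (forall x, (count (< x) s <= i + count (< x) t)%N) -> (i + n < size s)%N ->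
  t`_n <= s`_(i + n).
Proof.
move=> ss st h ns; apply: nth_count_ge => //; rewrite ns andbT.
apply: leq_trans (h _) _; rewrite leq_add2l leqNgt; apply/negP => lt_n.
by have := nth_count_lt 0 st lt_n; rewrite ltxx.
Qed.

(** Here [i] is the allowed loss of negative directions from [L] to [M]. Corrected by the initial
    indices [j] and [l], it becomes the shift [e] between the positions of the eigenvalues
    compared. *)
Lemma nth_le_of_neg m n (L : R -> 'M[C]_m) (M : R -> 'M[C]_n) j l s t i e :
  pencil_spec L j s -> pencil_spec M l t ->
  (forall x k, has_neg (L x) (i + k) -> has_neg (M x) k) ->
  (i + l = e + j)%N ->
  forall r, (e + r < size s)%N -> t`_r <= s`_(e + r).
Proof.
move=> hs ht h E r; case: (hs) (ht) => ss _ _ [st _ _]; apply: nth_le_of_count => // x.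
by have := pencil_spec_count h hs ht x; lia.
Qed.

(** A nonzero pivot costs one dimension. A vanishing one costs the two dimensions of a hyperbolic
    plane, hence one eigenvalue less, and contributes one negative direction just as a negative
    pivot does. *)
Lemma pencil_semidefinite n (H : 'M[C]_n.+2) (om : 'rV[R]_n.+2) c :
  H^t* = H -> H 0 0 = Cr c -> H 1 0 != 0 ->
  om 0 0 = 0 -> (forall i, i != 0 -> 0 < om 0 i) ->
  exists2 s, pencil_spec (pencil H om) (c <= 0)%R s & size s = if c == 0 then n else n.+1.
Proof.
move=> hH Hc H10 om0 h; have [c0|c0] := eqVneq c 0.
  by rewrite c0 lexx; apply: pencil_zero => //; rewrite Hc c0.
have := @pencil_nonzero R n.+1 H om hH; rewrite Hc (ltcR _ 0) => /(_ _ om0 h).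
rewrite lt_neqAle c0 /=; apply.
by apply: contra c0 => /eqP/complexI->.
Qed.

End Eigenlist.

(** * The pencils of the three boundary conditions *)

Section Spec.
Variable R : rcfType.
Local Notation C := (R[i]).
Local Notation Cr x := (real_complex R x).
Implicit Types (N : nat) (f q w : nat -> R) (a b : R) (z : C).

Lemma sl_coef_conj N f q a b z i j : (sl_coef N f q a b z j i)^* = sl_coef N f q a b z i j.
Proof.
rewrite /sl_coef !(rmorphD, rmorphN, rmorphMn) /= !conjCr conjCK.
rewrite [i == j]eq_sym [(i == 0) && _]andbC [(i == N) && _]andbC.
case: (eqVneq j i) => [->|_]; first by ring.
by rewrite !mulr0n; ring.
Qed.

Lemma sl_coef_herm N f q m a b z (u : nat -> nat) :
  (\matrix_(i < m, j < m) sl_coef N f q a b z (u i) (u j))^t* =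
  \matrix_(i < m, j < m) sl_coef N f q a b z (u i) (u j).
Proof. by apply/matrixP => i j; rewrite !mxE /= sl_coef_conj. Qed.

Lemma sl_coef00 N f q a b z : (0 < N)%N -> sl_coef N f q a b z 0 0 = Cr (a + f 0).
Proof. by case: N => // N _; rewrite /sl_coef /= !mulr0n mulr1n !subr0 !addr0. Qed.

Lemma sl_coef10 N f q a b z : (1 < N)%N -> sl_coef N f q a b z 1 0 = - Cr (f 0).
Proof. by case: N => [|[|N]] // _; rewrite /sl_coef /= !mulr0n mulr1n; ring. Qed.

Lemma sl_specA N f q w a b z : (2 <= N)%N -> (forall n, (n <= N)%N -> f n != 0) ->
  (forall n, (1 <= n <= N)%N -> 0 < w n) -> exists2 s,
  pencil_spec (pencil (sl_mxA N f q a b z) (sl_wA N w)) (a <= - f 0)%R s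
  & size s = if a == - f 0 then N.-1 else N.
Proof.
rewrite -[a == _]subr_eq0 -[a <= _]subr_le0 opprK; case: N => [|n] // N2 f0 w0.
apply: pencil_semidefinite.
- exact: (sl_coef_herm _ _ _ _ _ _ _ id).
- by rewrite mxE sl_coef00.
- by rewrite mxE sl_coef10 // oppr_eq0 fmorph_eq0 f0.
- by rewrite mxE.
- move=> i i0; rewrite mxE /sl_weight; case: i i0 => -[|i] //= i2 _.
  by apply: w0; rewrite /= -ltnS.
Qed.

Lemma sl_specS3 N f q w b : (forall n, (1 <= n <= N)%N -> 0 < w n) -> exists2 s,
  pencil_spec (pencil (sl_mxS3 N f q b) (sl_wS3 N w)) 0 s & size s = N.
Proof.
move=> w0; apply: pencil_definite; first exact: (sl_coef_herm _ _ _ _ _ _ _ succn).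
by move=> i; rewrite mxE /sl_weight /= w0 /=.
Qed.

Lemma sl_specS4 N f q w a : (2 <= N)%N -> (forall n, (n <= N)%N -> f n != 0) ->
  (forall n, (1 <= n <= N)%N -> 0 < w n) -> exists2 s,
  pencil_spec (pencil (sl_mxS4 N f q a) (sl_wS4 N w)) (a <= - f 0)%R s
  & size s = if a == - f 0 then (N - 2)%N else N.-1.
Proof.
rewrite -[a == _]subr_eq0 -[a <= _]subr_le0 opprK; case: N => [|[|n]] // N2 f0 w0.
rewrite subSS subSS subn0; apply: pencil_semidefinite.
- exact: (sl_coef_herm _ _ _ _ _ _ _ id).
- by rewrite mxE sl_coef00.
- by rewrite mxE sl_coef10 // oppr_eq0 fmorph_eq0 f0.
- by rewrite mxE.
- move=> i i0; rewrite mxE /sl_weight; case: i i0 => -[|i] //= i2 _.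
  by apply: w0; rewrite /= ltnW.
Qed.

Lemma has_neg_mxA N f q w a1 a2 b1 b2 z x k : a1 <= a2 -> b1 <= b2 -> (0 < N)%N ->
  has_neg (pencil (sl_mxA N f q a2 b2 z) (sl_wA N w) x) k ->
  has_neg (pencil (sl_mxA N f q a1 b1 z) (sl_wA N w) x) k.
Proof.
move=> ha hb N0; apply: has_neg_le_form => u.
(* Raising [a] and [b] adds this nonnegative diagonal, supported at the two extreme indices. *)
pose e : 'rV[R]_N.+1 := \row_i (if i == 0%N :> nat then a2 - a1 else
  if i == N :> nat then b2 - b1 else 0).
have -> : pencil (sl_mxA N f q a2 b2 z) (sl_wA N w) x =
    pencil (sl_mxA N f q a1 b1 z) (sl_wA N w) x + rdiag e.
  apply/matrixP => i j; rewrite [RHS]mxE !pencilE rdiagE !mxE /sl_coef [X in _ *+ X]/=.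
  rewrite -!val_eqE /=; case: (_ =P nat_of_ord j) => _; last by rewrite !mulr0n; ring.
  rewrite !mulr1n; do 2?[case: eqP => _]; rewrite !(rmorphD, rmorphN, rmorph0) /=; ring.
rewrite [leRHS]hformD lerDl hform_diag; apply: sumr_ge0 => i _.
rewrite mulr_ge0 ?exprn_ge0 // !mxE (lecR 0).
by do 2?[case: eqP => _]; rewrite ?subr_ge0.
Qed.

(** [a] and [z] occur only in the deleted row and column, so the same [S_3] pencil is a minor for
    every [a]. *)
Lemma pencil_mxS3 N f q w a b z x : (0 < N)%N ->
  pencil (sl_mxS3 N f q b) (sl_wS3 N w) x =
  row' ord0 (col' ord0 (pencil (sl_mxA N f q a b z) (sl_wA N w) x)).
Proof.
move=> N0; apply/matrixP => i j.
rewrite [RHS]mxE [RHS]mxE !pencilE !mxE -!val_eqE /= /bump /= !add1n eqSS.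
by rewrite /sl_coef /= !andbF.
Qed.

Lemma pencil_mxS4 N f q w a b z x :
  pencil (sl_mxS4 N f q a) (sl_wS4 N w) x =
  row' ord_max (col' ord_max (pencil (sl_mxA N f q a b z) (sl_wA N w) x)).
Proof.
apply/matrixP => i j.
have iN : bump N i = i by rewrite /bump leqNgt ltn_ord.
have jN : bump N j = j by rewrite /bump leqNgt ltn_ord.
rewrite [RHS]mxE [RHS]mxE !pencilE !mxE -!val_eqE /= iN jN.
have := ltn_ord i; have := ltn_ord j; rewrite /sl_coef.
by do 2!case: (_ =P N) => [->|_]; rewrite ?ltnn // ?andbF !mulr0n.
Qed.

End Spec.

Section Lists.
Variable R : rcfType.
Local Notation C := (R[i]).
Local Notation Cr x := (real_complex R x).
Variables (N : nat) (f q w : nat -> R).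
Hypothesis N2 : (2 <= N)%N.
Hypothesis f0 : forall n, (n <= N)%N -> f n != 0.
Hypothesis w0 : forall n, (1 <= n <= N)%N -> 0 < w n.
Implicit Types (a b : R) (z : C) (s : seq R).

Lemma CrfN_neq0 : Cr (f N) != 0.
Proof. by rewrite fmorph_eq0 f0. Qed.

Lemma sl_eigenlistA a b z : exists2 s,
  sl_eigenlist N f q w (bcA_A a z) (bcA_B b z) s &
  pencil_spec (pencil (sl_mxA N f q a b z) (sl_wA N w)) (a <= - f 0)%R s
  /\ size s = if a == - f 0 then N.-1 else N.
Proof.
have [s hs ss] := sl_specA q a b z N2 f0 w0; exists s => //.
apply: (sl_eigenlist_pencil _ _ hs) => [|x]; last first.
  by rewrite sl_charpolyE // det_bcA //.
by rewrite mulf_neq0 ?CrfN_neq0 // signr_eq0.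
Qed.

Lemma sl_eigenlistS3 b : exists2 s,
  sl_eigenlist N f q w (bcS3_A R) (bcS3_B b) s &
  pencil_spec (pencil (sl_mxS3 N f q b) (sl_wS3 N w)) 0 s /\ size s = N.
Proof.
have [s hs ss] := sl_specS3 f q b w0; exists s => //.
apply: (sl_eigenlist_pencil _ _ hs) => [|x]; last first.
  by rewrite sl_charpolyE // det_bcS3 //.
by rewrite mulf_neq0 ?CrfN_neq0 // signr_eq0.
Qed.

Lemma sl_eigenlistS4 a : exists2 s,
  sl_eigenlist N f q w (bcS4_A a) (bcS4_B R) s &
  pencil_spec (pencil (sl_mxS4 N f q a) (sl_wS4 N w)) (a <= - f 0)%R s
  /\ size s = if a == - f 0 then (N - 2)%N else N.-1.
Proof.
have [s hs ss] := sl_specS4 q a N2 f0 w0; exists s => //.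
apply: (sl_eigenlist_pencil _ _ hs) => [|x]; last first.
  by rewrite sl_charpolyE // det_bcS4 //.
by rewrite !mulf_neq0 ?oppr_eq0 ?CrfN_neq0 // signr_eq0.
Qed.

End Lists.

Theorem theorem3p3 (R : rcfType) (N : nat) (f q w : nat -> R) (z : R[i]) :
  (2 <= N)%N ->
  (forall n, (n <= N)%N -> f n != 0) ->
  (forall n, (1 <= n <= N)%N -> 0 < w n) ->
  (* numbers of eigenvalues *)
  [/\ (forall a11 b21 : R, exists s : seq R,
         sl_eigenlist N f q w (bcA_A a11 z) (bcA_B b21 z) s /\
         size s = (if a11 == - f 0%N then N.-1 else N)),
      (forall b21 : R, exists s : seq R,
         sl_eigenlist N f q w (bcS3_A R) (bcS3_B b21) s /\ size s = N),
      (forall a11 : R, exists s : seq R,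
         sl_eigenlist N f q w (bcS4_A a11) (bcS4_B R) s /\
         size s = (if a11 == - f 0%N then (N - 2)%N else N.-1)),
  (* (i) dependence on a11 *)
      (forall (a1 a2 a3 a4 b21 : R) (l1 l2 l3 l4 lS : seq R),
         a1 < a2 -> a2 <= - f 0%N -> - f 0%N < a3 -> a3 < a4 ->
         sl_eigenlist N f q w (bcA_A a1 z) (bcA_B b21 z) l1 ->
         sl_eigenlist N f q w (bcA_A a2 z) (bcA_B b21 z) l2 ->
         sl_eigenlist N f q w (bcA_A a3 z) (bcA_B b21 z) l3 ->
         sl_eigenlist N f q w (bcA_A a4 z) (bcA_B b21 z) l4 ->
         sl_eigenlist N f q w (bcS3_A R) (bcS3_B b21) lS ->
         [/\ forall n, (n < N)%N ->
               [/\ l3`_n <= l4`_n, l4`_n <= lS`_n & lS`_n <= l1`_n],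
             forall n, (n < N.-1)%N ->
               l1`_n <= l2`_n /\ l2`_n <= l3`_n.+1
           & a2 < - f 0%N -> l1`_(N.-1) <= l2`_(N.-1)])
    & (* (ii) dependence on b21 *)
      (forall (a11 b1 b2 : R) (m1 m2 mS : seq R),
         b1 < b2 ->
         sl_eigenlist N f q w (bcA_A a11 z) (bcA_B b1 z) m1 ->
         sl_eigenlist N f q w (bcA_A a11 z) (bcA_B b2 z) m2 ->
         sl_eigenlist N f q w (bcS4_A a11) (bcS4_B R) mS ->
         [/\ forall n, (n < N - 2)%N ->
               [/\ m1`_n <= m2`_n, m2`_n <= mS`_n & mS`_n <= m1`_n.+1],
             m1`_(N - 2) <= m2`_(N - 2)
           & a11 != - f 0%N ->
               [/\ m2`_(N - 2) <= mS`_(N - 2), mS`_(N - 2) <= m1`_(N.-1)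
                 & m1`_(N.-1) <= m2`_(N.-1)]])].
Proof.
move=> N2 f0 w0.
have NL : (0 < N)%N by lia.
split.
- move=> a b; have [s hs [_ ss]] := sl_eigenlistA q N2 f0 w0 a b z; by exists s.
- move=> b; have [s hs [_ ss]] := sl_eigenlistS3 q N2 f0 w0 b; by exists s.
- move=> a; have [s hs [_ ss]] := sl_eigenlistS4 q N2 f0 w0 a; by exists s.
- move=> a1 a2 a3 a4 b l1 l2 l3 l4 lS a12 a2f a3f a34 h1 h2 h3 h4 hS.
  have [s1 /(sl_eigenlist_inj h1) <- [p1 z1]] := sl_eigenlistA q N2 f0 w0 a1 b z.
  have [s2 /(sl_eigenlist_inj h2) <- [p2 z2]] := sl_eigenlistA q N2 f0 w0 a2 b z.
  have [s3 /(sl_eigenlist_inj h3) <- [p3 z3]] := sl_eigenlistA q N2 f0 w0 a3 b z.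
  have [s4 /(sl_eigenlist_inj h4) <- [p4 z4]] := sl_eigenlistA q N2 f0 w0 a4 b z.
  have [s5 /(sl_eigenlist_inj hS) <- [pS zS]] := sl_eigenlistS3 q N2 f0 w0 b.
  have a1f : a1 < - f 0 := lt_le_trans a12 a2f.
  have a4f : - f 0 < a4 := lt_trans a3f a34.
  (* The initial negative index is 1 for [a1] and [a2], and 0 for [a3], [a4] and [S_3]. *)
  rewrite (lt_eqF a1f) (ltW a1f) in z1 p1; rewrite a2f in p2.
  rewrite (gt_eqF a3f) (lt_geF a3f) in z3 p3; rewrite (gt_eqF a4f) (lt_geF a4f) in z4 p4.
  have mono a a' : a < a' -> forall x k,
      has_neg (pencil (sl_mxA N f q a' b z) (sl_wA N w) x) (0 + k) ->
      has_neg (pencil (sl_mxA N f q a b z) (sl_wA N w) x) k.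
    by move=> /ltW aa' x k; apply: has_neg_mxA.
  split.
  + move=> n nN; split.
    * by apply: (nth_le_of_neg (e := 0) p4 p3 (mono _ _ a34)) => //; rewrite z4.
    * apply: (nth_le_of_neg (e := 0) (i := 0) pS p4) => //; last by rewrite zS.
      by move=> x k; rewrite (pencil_mxS3 f q w a4 b z x NL); apply: has_neg_minor.
    (* The direction lost by deleting row 0 is offset by the initial index 1 of [a1], so positions
       do not shift. *)
    * apply: (nth_le_of_neg (e := 0) (i := 1) p1 pS) => //; last by rewrite z1.
      by move=> x k; rewrite (pencil_mxS3 f q w a1 b z x NL); apply: minor_has_neg.
  + move=> n nN; split.
      apply: (nth_le_of_neg (e := 0) p2 p1 (mono _ _ a12)) => //.
      by rewrite z2; case: ifP => _; lia.
    (* Between [a2] and [a3] the pivot becomes positive and the initial index drops from 1 to 0,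
       which shifts positions by one. *)
    apply: (nth_le_of_neg (e := 1) p3 p2 (mono _ _ (le_lt_trans a2f a3f))) => //.
    by rewrite z3; lia.
  + move=> a2f'; apply: (nth_le_of_neg (e := 0) p2 p1 (mono _ _ a12)) => //.
    by rewrite z2 (lt_eqF a2f'); lia.
- move=> a b1 b2 l1 l2 lS b12 h1 h2 hS.
  have [s1 /(sl_eigenlist_inj h1) <- [p1 z1]] := sl_eigenlistA q N2 f0 w0 a b1 z.
  have [s2 /(sl_eigenlist_inj h2) <- [p2 z2]] := sl_eigenlistA q N2 f0 w0 a b2 z.
  have [s5 /(sl_eigenlist_inj hS) <- [pS zS]] := sl_eigenlistS4 q N2 f0 w0 a.
  have le12 n : (n < size l2)%N -> l1`_n <= l2`_n.
    have mono x k : has_neg (pencil (sl_mxA N f q a b2 z) (sl_wA N w) x) (0 + k) ->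
        has_neg (pencil (sl_mxA N f q a b1 z) (sl_wA N w) x) k.
      by apply: has_neg_mxA => //; apply: ltW.
    exact: (nth_le_of_neg (e := 0) p2 p1 mono).
  have le2S n : (n < size lS)%N -> l2`_n <= lS`_n.
    apply: (nth_le_of_neg (e := 0) (i := 0) pS p2) => // x k.
    by rewrite (pencil_mxS4 N f q w a b2 z x); apply: has_neg_minor.
  (* Both initial indices depend only on [a] and agree, so the direction lost in the minor becomes a
     shift by one. *)
  have leS1 n : (n.+1 < size l1)%N -> lS`_n <= l1`_n.+1.
    apply: (nth_le_of_neg (e := 1) (i := 1) p1 pS) => // x k.
    by rewrite (pencil_mxS4 N f q w a b1 z x); apply: minor_has_neg.
  split.
  + by move=> n nN; split; [apply: le12 | apply: le2S | apply: leS1];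
      rewrite ?z1 ?z2 ?zS; case: ifP => _; lia.
  + by apply: le12; rewrite z2; case: ifP => _; lia.
  (* Away from [- f 0] the lists have lengths N, N and N-1, which allows one more round of
     comparisons at position N-2. *)
  + move=> /negPf af; rewrite af in z1 z2 zS.
    have -> : N.-1 = (N - 2).+1 by lia.
    by split; [apply: le2S | apply: leS1 | apply: le12]; rewrite ?z1 ?z2 ?zS; lia.
Qed.
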